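(* Let $V$ be a locally linearly compact vector space over a finite (discrete) field $\mathbb F$ and let $\phi\colon V\to V$ be a continuous endomorphism. Then $$h_{alg}(\phi)=\mathrm{ent}(\phi)\cdot\log|\mathbb F|.$$
   Context: A topological vector space over a discrete field is linearly topologized if it is Hausdorff and has a neighborhood basis at $0$ consisting of linear subspaces. A linear variety of $V$ is a coset $v+W$ of a linear subspace $W$; it is closed (open) if $W$ is closed (open). A linearly topologized vector space is linearly compact if every collection of closed linear varieties with the finite intersection property has non-empty intersection. A linearly topologized vector space is locally linearly compact (l.l.c.) if it has an open linear subspace that is linearly compact; $\mathcal B(V)$ denotes the family of all linearly compact open linear subspaces of $V$. ''Endomorphism'' of a vector space means linear endomorphism. For a continuous endomorphism $\phi$ of an l.l.c. space $V$ (or of a topological abelian group), a subspace (subgroup) $U$ and a positive integer $n$, let $T_n(\phi,U)=U+\phi U+\dots+\phi^{n-1}U$. For $U\in\mathcal B(V)$ define $H(\phi,U)=\lim_{n\to\infty}\frac1n\dim\frac{T_n(\phi,U)}{U}$ (the limit exists) and $\mathrm{ent}(\phi)=\sup\{H(\phi,U)\mid U\in\mathcal B(V)\}\in\mathbb N\cup\{\infty\}$. A topological abelian group $G$ is compactly covered if each element of $G$ lies in some compact subgroup of $G$. For a compactly covered locally compact abelian group $G$, let $\mathcal B_{gr}(G)$ be the family of all compact open subgroups of $G$; the algebraic entropy $h_{alg}$ of a continuous endomorphism $\phi\colon G\to G$ is given by $$h_{alg}(\phi)=\sup\{H_{alg}(\phi,U)\mid U\in\mathcal B_{gr}(G)\},\qquad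 H_{alg}(\phi,U)=\lim_{n\to\infty}\frac1n\log\left|\frac{T_n(\phi,U)}{U}\right|.$$ An l.l.c. vector space over a finite field is a totally disconnected, compactly covered locally compact abelian group, so $h_{alg}(\phi)$ is defined this way for its continuous endomorphisms. *)

(* Defs.v *)
From HB Require Import structures.
From mathcomp Require Import all_boot all_order all_algebra.
From mathcomp Require Import all_classical all_reals all_analysis.

Set Implicit Arguments.
Unset Strict Implicit.
Unset Printing Implicit Defensive.

Import Order.TTheory GRing.Theory Num.Theory.

Local Open Scope classical_set_scope.
Local Open Scope ring_scope.

(* The library's topologicalLmodType K takes its scalars in a numDomainType with
   the norm topology, hence excludes finite fields; here the scalars form an
   arbitrary field with the discrete topology. This is a plain record because
   HB rejects a second join of Topological and Lmodule whose scalars are not a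
   numDomainType. *)
Record discreteTvsType (K : fieldType) : Type := DiscreteTvs {
  dtvs_zmod : topologicalZmodType ;
  dtvs_lmodule : GRing.Zmodule_isLmodule K dtvs_zmod ;
  dtvs_scale_continuous : continuous
    (fun z : discrete_topology K * dtvs_zmod =>
       GRing.Zmodule_isLmodule.scale dtvs_lmodule z.1 z.2)
}.

Definition dtvs_sort (K : fieldType) (V : discreteTvsType K) : Type :=
  dtvs_zmod V.
Coercion dtvs_sort : discreteTvsType >-> Sortclass.

HB.instance Definition _ (K : fieldType) (V : discreteTvsType K) :=
  TopologicalZmodule.on (dtvs_sort V).
HB.instance Definition _ (K : fieldType) (V : discreteTvsType K) :=
  (dtvs_lmodule V : GRing.Zmodule_isLmodule K (dtvs_sort V)).

Lemma scale_discrete_continuous (K : fieldType) (V : discreteTvsType K) :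
  continuous (fun z : discrete_topology K * V => (z.1 : K) *: z.2).
Proof. exact: dtvs_scale_continuous. Qed.

Definition coset_set (G : zmodType) (v : G) (W : set G) : set G := +%R v @` W.

Definition add_set (G : zmodType) (A B : set G) : set G :=
  [set a + b | a in A & b in B].

Definition trajectory (G : zmodType) (phi : G -> G) (n : nat) (U : set G) :
  set G := \big[@add_set G/[set 0]]_(i < n) (iter i phi @` U).

Section LinearTopology.
Context {K : fieldType} {V : discreteTvsType K}.

Definition is_subspace (W : set V) : Prop := submod_closed [in W].

Definition linearly_topologized : Prop :=
  hausdorff_space V /\
  forall N : set V, nbhs 0 N ->
    exists W : set V, [/\ is_subspace W, nbhs 0 W & W `<=` N].

(* In the linear subspace U, for the topology induced by V. *)
Definition closed_linear_variety_in (U A : set V) : Prop :=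
  exists v W, [/\ U v, is_subspace W, W `<=` U,
    closed (W : set (subspace U)) & A = coset_set v W].

(* Linear compactness of the linear subspace U for the induced topology, which
   is linear as soon as that of V is. *)
Definition linearly_compact (U : set V) : Prop :=
  forall C : set (set V), C `<=` closed_linear_variety_in U ->
    finI C id -> \bigcap_(A in C) A !=set0.

Definition lc_open_subspaces : set (set V) :=
  [set U | [/\ is_subspace U, open U & linearly_compact U]].

End LinearTopology.

Arguments linearly_topologized {K} V.
Arguments lc_open_subspaces {K} V.

Definition locally_linearly_compact (K : fieldType) (V : discreteTvsType K) :
  Prop := linearly_topologized V /\ lc_open_subspaces V !=set0.

Section QuotientDimension.
Context (R : realType) {K : fieldType} {V : lmodType K}.

(* The classes of the e i form a basis of W / U. *)
Definition quotient_basis (W U : set V) (n : nat) (e : 'I_n -> V) : Prop :=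
  [/\ forall i, W (e i),
      forall c : 'I_n -> K,
        U (\sum_(i < n) c i *: e i) -> forall i, c i = 0 &
      forall w, W w -> exists c : 'I_n -> K, U (w - \sum_(i < n) c i *: e i)].

(* The set below is {dim (W / U)} if W / U is finite-dimensional, and otherwise
   it is empty and has infimum +oo. *)
Definition quotient_dim (W U : set V) : \bar R :=
  ereal_inf [set n%:R%:E | n in
    [set n : nat | exists e : 'I_n -> V, quotient_basis W U e]].

End QuotientDimension.

Section Entropy.
Context (R : realType) {K : fieldType} {V : discreteTvsType K}.
Local Open Scope ereal_scope.

Definition ent_at (phi : V -> V) (U : set V) : \bar R :=
  limn (fun n => (n%:R^-1)%:E * quotient_dim R (trajectory phi n U) U).

Definition ent (phi : V -> V) : \bar R :=
  ereal_sup [set ent_at phi U | U in lc_open_subspaces V].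

End Entropy.

Section AlgebraicEntropy.
Context (R : realType) {G : topologicalZmodType}.

Definition compact_open_subgroups : set (set G) :=
  [set U | [/\ zmod_closed [in U], compact U & open U]].

Definition quotient_set (W U : set G) : set (set G) :=
  [set coset_set w U | w in W].

Local Open Scope ereal_scope.

Definition halg_at (phi : G -> G) (U : set G) : \bar R :=
  limn (fun n => (n%:R^-1)%:E *
    lne (counting (quotient_set (trajectory phi n U) U))).

Definition halg (phi : G -> G) : \bar R :=
  ereal_sup [set halg_at phi U | U in compact_open_subgroups].

End AlgebraicEntropy.

(* Main.v *)
Require Import Defs.
From HB Require Import structures.
From mathcomp Require Import all_boot all_order all_algebra finmap.
From mathcomp Require Import all_classical all_reals all_analysis.

(* If U is a compact open subgroup and T_n = T_n(phi, U), then phi induces a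
   surjection of T_(n+1)/T_n onto T_(n+2)/T_(n+1). The indices [T_(n+1) : T_n] are
   therefore eventually constant, say equal to d, and (1/n) log |T_n/U| tends to
   log d. If U <= U' then |T_n(U)/U| <= |T_n(U')/U'| * |U'/U|, so the limit is
   monotone in U. Over a finite field F, a compact open subgroup U lies in the
   compact open linear subspace sum_(a : F) a U, so the supremum defining halg may
   be taken over the compact open linear subspaces. These are exactly the linearly
   compact open ones, and for them |T_n/U| = |F|^dim(T_n/U). *)

Set Implicit Arguments.
Unset Strict Implicit.
Unset Printing Implicit Defensive.

Import Order.TTheory GRing.Theory Num.Theory numFieldNormedType.Exports.

Local Open Scope classical_set_scope.
Local Open Scope ring_scope.

(** * Subgroups of an abelian group and their cosets *)

Section Subgroups.
Context {G : zmodType} (W : set G) (Wsub : zmod_closed [in W]).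

Lemma subgroup0 : W 0.
Proof. by case: Wsub => /set_mem. Qed.

Lemma subgroupB x y : W x -> W y -> W (x - y).
Proof.
by move=> Wx Wy; case: Wsub => _ /(_ x y); rewrite !inE => /(_ Wx Wy).
Qed.

Lemma subgroupN x : W x -> W (- x).
Proof. by rewrite -(sub0r x); apply: subgroupB; exact: subgroup0. Qed.

Lemma subgroupD x y : W x -> W y -> W (x + y).
Proof. by move=> Wx Wy; rewrite -[y]opprK; apply/subgroupB/subgroupN. Qed.

Lemma subgroup_sum (I : Type) (r : seq I) (P : pred I) (u : I -> G) :
  (forall i, P i -> W (u i)) -> W (\sum_(i <- r | P i) u i).
Proof. by move=> Wu; elim/big_ind: _ => //; [exact: subgroup0 | exact: subgroupD]. Qed.

Lemma subgroup_subrC x y : W (x - y) -> W (y - x).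
Proof. by move=> /subgroupN; rewrite opprB. Qed.

Lemma coset_setE v x : coset_set v W x = W (x - v).
Proof.
apply/propext; split=> [[w Ww <-]|Wx]; first by rewrite addrC addKr.
by exists (x - v) => //; rewrite addrC subrK.
Qed.

Lemma coset_set_eq x y : (coset_set x W = coset_set y W) <-> W (x - y).
Proof.
split=> [|Wxy]; first move/seteqP=> [/(_ x)+ _].
  by rewrite !coset_setE subrr => /(_ subgroup0).
apply/seteqP; split=> z; rewrite !coset_setE => Wz.
  by rewrite -(subrK x z) -addrA; exact: subgroupD.
by rewrite -(subrK y z) -addrA; apply/subgroupD/subgroup_subrC.
Qed.

End Subgroups.

Lemma subgroup_intro (G : zmodType) (W : set G) :
  W 0 -> (forall x y, W x -> W y -> W (x - y)) -> zmod_closed [in W].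
Proof. by move=> W0 WB; split=> [|x y]; rewrite !inE //; exact: WB. Qed.

Lemma card_finType (I : finType) : ([set: I] #= `I_#|I|)%card.
Proof.
rewrite (card_eqr card_II) card_eq_sym.
have <- : range (@enum_rank I) = [set: 'I_#|I|].
  by apply/seteqP; split=> // i _; exists (enum_val i); rewrite ?enum_valK.
apply: inj_card_eq => i j _ _; exact: enum_rank_inj.
Qed.

(** * Index of a subgroup, by covers and transversals *)

Section Index.
Context {G : topologicalZmodType}.
Implicit Types A B C : set G.

(** [fset_set] sends an infinite set to the empty one, so an infinite index reads as 0; finiteness
    of the quotient is tracked separately. *)
Definition subgroup_index A B : nat := #|` fset_set (quotient_set A B)|.

(** The representatives may lie outside [A], as can happen when they come from a cover of a compact
    set by open cosets. *)
Definition coset_cover (I : Type) A B (e : I -> G) :=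
  forall a, A a -> exists i, B (a - e i).

Definition coset_transversal (I : Type) A B (e : I -> G) :=
  [/\ forall i, A (e i), forall i j, B (e i - e j) -> i = j & coset_cover A B e].

Lemma quotient_set_cover (I : Type) A B (e : I -> G) :
  zmod_closed [in B] -> coset_cover A B e ->
  quotient_set A B `<=` range (fun i => coset_set (e i) B).
Proof.
by move=> Bsub cov _ [a /cov[i Bi] <-]; exists i => //; apply/esym/coset_set_eq.
Qed.

Lemma finite_quotient_cover (I : finType) A B (e : I -> G) :
  zmod_closed [in B] -> coset_cover A B e -> finite_set (quotient_set A B).
Proof.
move=> Bsub /quotient_set_cover cov; apply: sub_finite_set (cov Bsub) _.
exact/finite_image/finite_finset.
Qed.

Lemma index_cover (I : finType) A B (e : I -> G) :
  zmod_closed [in B] -> coset_cover A B e -> (subgroup_index A B <= #|I|)%N.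
Proof.
move=> Bsub /quotient_set_cover cov; apply: geq_card_fset_set.
rewrite -(card_le_eqr (card_finType I)).
apply: card_le_trans (subset_card_le (cov Bsub)) (card_image_le _ _).
Qed.

Lemma index_transversal (I : finType) A B (e : I -> G) :
  zmod_closed [in B] -> coset_transversal A B e -> subgroup_index A B = #|I|.
Proof.
move=> Bsub [Ae einj cov]; apply: card_fset_set.
have -> : quotient_set A B = range (fun i => coset_set (e i) B).
  apply/seteqP; split; first exact: quotient_set_cover.
  by move=> _ [i _ <-]; exists (e i).
rewrite -(card_eqr (card_finType I)); apply: inj_card_eq => i j _ _ /coset_set_eq.
by move=> /(_ Bsub)/einj.
Qed.

Lemma transversal_exists A B :
  zmod_closed [in B] -> finite_set (quotient_set A B) ->
  exists (I : finType) (e : I -> G), coset_transversal A B e.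
Proof.
move=> Bsub fin.
pose I : finType := fset_set (quotient_set A B).
have /choice[e eP] : forall i : I, exists a, A a /\ coset_set a B = val i.
  move=> i; have := valP i; rewrite in_fset_set// inE => -[a Aa <-].
  by exists a.
exists I, e; split=> [i|i j Bij|a Aa]; first by have [] := eP i.
  by apply: val_inj; rewrite /= -(eP i).2 -(eP j).2; apply/coset_set_eq.
have aI : coset_set a B \in fset_set (quotient_set A B).
  by rewrite in_fset_set// inE; exists a.
by exists (FSetSub aI); apply/coset_set_eq => //; rewrite (eP _).2.
Qed.

Lemma index_gt0 A B : zmod_closed [in B] -> finite_set (quotient_set A B) ->
  A !=set0 -> (0 < subgroup_index A B)%N.
Proof.
move=> Bsub /[dup] fin /(transversal_exists Bsub)[I [e /[dup] tr [_ _ cov]]].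
move=> [a /cov[i _]].
by rewrite (index_transversal Bsub tr); apply/card_gt0P; exists i.
Qed.

(** The sums [e i + f j] of representatives of [A/B] and [B/C] form a transversal of [A/C], which
    yields finiteness and the product formula together. *)
Lemma index_mul A B C : zmod_closed [in A] ->
  zmod_closed [in B] -> zmod_closed [in C] -> B `<=` A -> C `<=` B ->
  finite_set (quotient_set A B) -> finite_set (quotient_set B C) ->
  finite_set (quotient_set A C) /\
  subgroup_index A C = (subgroup_index A B * subgroup_index B C)%N.
Proof.
move=> Asub Bsub Csub BA CB /(transversal_exists Bsub)[I [e etr]].
move=> /(transversal_exists Csub)[J [f ftr]].
rewrite (index_transversal Bsub etr) (index_transversal Csub ftr) -card_prod.
suff tr : coset_transversal A C (fun p : I * J => e p.1 + f p.2).
  split; last exact: index_transversal tr.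
  by have [_ _ cov] := tr; exact: finite_quotient_cover cov.
have [[Ae einj ecov] [Bf finj fcov]] := (etr, ftr).
split=> [[i j]|[i j] [i' j'] /= Cij|a Aa] /=.
- by apply: subgroupD => //; exact: BA.
- have ii' : i = i'.
    apply: einj; have -> : e i - e i' = (e i + f j - (e i' + f j')) + (f j' - f j).
      by rewrite opprD addrACA -!addrA (addrCA (- e i')) addNKr
        [_ + (_ - _)]addrC subrK addrC.
    by apply: subgroupD => //; [exact: CB | exact: subgroupB].
  rewrite ii'; congr pair; apply: finj.
  by move: Cij; rewrite ii' opprD addrACA subrr add0r.
- have [i Bai] := ecov a Aa; have [j Caj] := fcov _ Bai.
  by exists (i, j); rewrite opprD addrA.
Qed.

Lemma index_le A A' B : zmod_closed [in B] -> finite_set (quotient_set A' B) ->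
  A `<=` A' -> (subgroup_index A B <= subgroup_index A' B)%N.
Proof.
move=> Bsub fin AA'; apply: fsubset_leq_card.
have AAq : quotient_set A B `<=` quotient_set A' B by exact: image_subset.
by rewrite -fset_set_sub//; exact: sub_finite_set AAq fin.
Qed.

End Index.

(** * Trajectories as sets of finite sums *)

Section Trajectory.

(** Summands are chosen as a function of the index, so a repeated index would force equal summands;
    hence [uniq r]. *)
Lemma big_add_setP (G : zmodType) (I : eqType) (r : seq I) (A : I -> set G) x :
  uniq r ->
  (\big[@add_set G/[set 0]]_(i <- r) A i) x <->
  exists2 u : I -> G, (forall i, i \in r -> A i (u i)) & x = \sum_(i <- r) u i.
Proof.
elim: r x => [|i r IH] x /=.
  move=> _; split; first by rewrite big_nil => ->; exists (fun=> 0); rewrite ?big_nil.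
  by case=> u _ ->; rewrite !big_nil.
move=> /andP[iNr /[dup] r_uniq /IH{}IH]; rewrite big_cons.
split=> [[a Aa [b /IH[u Au ->] <-]]|[u Au ->]].
  exists (fun j => if j == i then a else u j) => [j|].
    by rewrite inE; case: eqP => [-> //|_ /= /Au].
  rewrite big_cons eqxx; congr (_ + _); apply: eq_big_seq => j jr.
  by case: eqP iNr => // <-; rewrite jr.
rewrite big_cons; exists (u i); first by apply: Au; rewrite mem_head.
exists (\sum_(j <- r) u j) => //.
by apply/IH; exists u => // j jr; apply: Au; rewrite inE jr orbT.
Qed.

Context {G : zmodType} (phi : {additive G -> G}) (U : set G).
Hypothesis Usub : zmod_closed [in U].
Local Notation T n := (trajectory phi n U).

(** The summands form a sequence on all of [nat], which can be shifted or cut off when [n]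
    changes. *)
Lemma trajectoryP n x : T n x <->
  exists2 u : nat -> G, (forall i, U (u i)) & x = \sum_(i < n) iter i phi (u i).
Proof.
rewrite /trajectory big_add_setP; last exact: index_enum_uniq.
split=> [[v vP ->]|[u Uu ->]]; last first.
  by exists (fun i : 'I_n => iter i phi (u i)) => // i _; exists (u i).
have /choice[w wP] : forall i : 'I_n, exists w, U w /\ iter i phi w = v i.
  by move=> i; have [w Uw <-] := vP i (mem_index_enum i); exists w.
exists (fun i => oapp w 0 (insub i)) => [i|].
  by case: insubP => [j _ _|_] /=; [exact: (wP j).1 | exact: subgroup0].
by apply: eq_bigr => i _; rewrite valK /= (wP i).2.
Qed.

Lemma iter_additiveB n : {morph iter n phi : x y / x - y}.
Proof. by elim: n => // n IH x y /=; rewrite IH raddfB. Qed.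

Lemma iter_additive0 n : iter n phi 0 = 0.
Proof. by elim: n => //= n ->; rewrite raddf0. Qed.

Lemma trajectory_subgroup n : zmod_closed [in T n].
Proof.
apply: subgroup_intro => [|x y /trajectoryP[u Uu ->] /trajectoryP[v Uv ->]].
  apply/trajectoryP; exists (fun=> 0) => [i|]; first exact: subgroup0.
  by rewrite big1 // => i _; rewrite iter_additive0.
apply/trajectoryP; exists (fun i => u i - v i) => [i|]; first exact: subgroupB.
by rewrite -sumrB; apply: eq_bigr => i _; rewrite iter_additiveB.
Qed.

(** Taking out the term of index 0 instead of the last one leaves a factor [phi]: this is how [phi]
    maps [T_n] onto [T_(n+1)] modulo [U]. *)
Lemma trajectory_recl n x :
  T n.+1 x <-> exists u y, [/\ U u, T n y & x = u + phi y].
Proof.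
rewrite trajectoryP; split=> [[u Uu ->]|[w [_ [Uw /trajectoryP[u Uu ->] ->]]]].
  exists (u 0), (\sum_(i < n) iter i phi (u i.+1)); split=> //.
    by apply/trajectoryP; exists (fun i => u i.+1).
  by rewrite big_ord_recl raddf_sum.
exists (fun i => if i is j.+1 then u j else w); first by case.
by rewrite big_ord_recl raddf_sum.
Qed.

Lemma trajectory1 : T 1 = U.
Proof.
apply/seteqP; split=> x; last first.
  by move=> Ux; apply/trajectoryP; exists (fun=> x); rewrite ?big_ord1.
by move=> /trajectoryP[u Uu ->]; rewrite big_ord1; exact: Uu.
Qed.

Lemma trajectory_subS n : T n `<=` T n.+1.
Proof.
move=> x /trajectoryP[u Uu ->]; apply/trajectoryP.
exists (fun i => if (i < n)%N then u i else 0) => [i|].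
  by case: ifP => // _; exact: subgroup0.
rewrite big_ord_recr /= ltnn iter_additive0 addr0.
by apply: eq_bigr => i _; rewrite ltn_ord.
Qed.

Lemma sub_trajectory n : U `<=` T n.+1.
Proof.
elim: n => [|n IH]; first by rewrite trajectory1.
exact: subset_trans IH (@trajectory_subS _).
Qed.

End Trajectory.

Lemma trajectory_subset (G : zmodType) (phi : {additive G -> G}) (U U' : set G) n :
  zmod_closed [in U] -> zmod_closed [in U'] -> U `<=` U' ->
  trajectory phi n U `<=` trajectory phi n U'.
Proof.
move=> Usub U'sub UU' x /trajectoryP-/(_ Usub)[u Uu ->].
by apply/trajectoryP => //; exists u => // i; exact: UU'.
Qed.

(** For [u + phi y] with [y - e i] in [T_n], subtracting [phi (e i)] leaves [u + phi (y - e i)],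
    which is in [T_(n+1)]. This is the surjectivity of the map induced by [phi] on successive
    quotients. *)
Lemma coset_cover_trajectory (G : topologicalZmodType) (phi : {additive G -> G})
    (U : set G) (I : Type) (e : I -> G) n : zmod_closed [in U] ->
  coset_cover (trajectory phi n.+1 U) (trajectory phi n U) e ->
  coset_cover (trajectory phi n.+2 U) (trajectory phi n.+1 U) (phi \o e).
Proof.
move=> Usub cov _ /trajectory_recl-/(_ Usub)[u [y [Uu Ty ->]]].
have [i Tyi] := cov y Ty; exists i; apply/trajectory_recl => //.
by exists u, (y - e i); rewrite raddfB addrA.
Qed.

(** * Open subgroups and compact sets *)

Section CompactOpen.
Context {G : topologicalZmodType}.
Implicit Types A B U : set G.

Lemma continuous_subr (x : G) : continuous (fun y : G => y - x).
Proof.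
move=> y; apply: (@continuous_comp _ _ _ (fun y => (y, x)) (fun p : G * G => p.1 - p.2)).
  by apply: cvg_pair => /=; [exact: cvg_id | exact: cvg_cst].
exact: sub_continuous.
Qed.

Lemma open_coset B x : open B -> open (coset_set x B).
Proof.
have -> : coset_set x B = (fun y => y - x) @^-1` B.
  by apply/seteqP; split=> y /=; rewrite coset_setE.
by move=> oB; apply: open_comp => // y _; exact: continuous_subr.
Qed.

Lemma nbhs_subgroup_open B : zmod_closed [in B] -> nbhs 0 B -> open B.
Proof.
move=> Bsub B0; rewrite openE => x Bx.
have : nbhs x ((fun y => y - x) @^-1` B) by apply: continuous_subr; rewrite subrr.
rewrite /interior/=; apply: filterS => y /= Byx.
by rewrite -(subrK x y); exact: subgroupD.
Qed.

Lemma open_subgroup_closed B : zmod_closed [in B] -> open B -> closed B.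
Proof.
move=> Bsub oB; rewrite -openC openE => x NBx.
apply: filterS (open_nbhs_nbhs (conj (open_coset x oB) _)) => [y|].
  rewrite coset_setE => Byx By; apply: NBx.
  by rewrite -(subKr y x); exact: subgroupB.
by rewrite coset_setE subrr; exact: subgroup0.
Qed.

Lemma compact_coset_cover A B : zmod_closed [in B] -> compact A -> open B ->
  exists (I : finType) (e : I -> G), coset_cover A B e.
Proof.
move=> Bsub cA oB.
(* [compact_cover] is only stated for pointed spaces. *)
pose G' : ptopologicalType := HB.pack (Topological.sort G) (isPointed.Build G 0).
have : @cover_compact G' A by rewrite -compact_cover.
move=> /(_ G setT (fun v => coset_set v B))[v _||D _ AD]; first exact: open_coset.
  by move=> a Aa; exists a => //; rewrite coset_setE subrr; exact: subgroup0.
exists D, val => a /AD[v /= Dv]; rewrite coset_setE => Bav.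
by exists (FSetSub Dv).
Qed.

Lemma compact_open_finite_quotient A B : zmod_closed [in B] -> compact A -> open B ->
  finite_set (quotient_set A B).
Proof.
move=> Bsub cA oB; have [I [e cov]] := compact_coset_cover Bsub cA oB.
exact: finite_quotient_cover cov.
Qed.

End CompactOpen.

(** * Growth of the indices along a trajectory *)

Lemma nonincreasing_nat_stationary (d : nat -> nat) :
  (forall n, (d n.+1 <= d n)%N) -> exists N, forall n, (N <= n)%N -> d n = d N.
Proof.
move=> dS.
have ex : exists m, `[< exists n, d n = m >] by exists (d 0); apply/asboolP; exists 0.
(* [N] is a place where the least value of [d] is attained. *)
case: (ex_minnP ex) => m /asboolP[N dN] dmin; exists N => n /subnK <-.
apply/eqP; rewrite eqn_leq; apply/andP; split.
  by elim: (n - N)%N => // k IH; rewrite addSn (leq_trans (dS _)).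
by rewrite dN; apply: dmin; apply/asboolP; exists (n - N + N)%N.
Qed.

(** Once [d] is constant, [ln (a n)] is affine in [n.+1] with slope [ln (d N)], and the intercept
    disappears after division. The divisor is [n.+1] because [a n] will be the index of [U] in
    [T_(n+1)]. *)
Lemma cvg_ln_growth (R : realType) (a d : nat -> nat) :
  (forall n, (0 < a n)%N) -> (forall n, a n.+1 = (d n * a n)%N) ->
  (forall n, (d n.+1 <= d n)%N) ->
  exists l : R, (n.+1%:R^-1 * ln (a n)%:R : R) @[n --> \oo] --> l.
Proof.
move=> a_gt0 aS /nonincreasing_nat_stationary[N dN].
have dN_gt0 : (0 < d N)%N by have := a_gt0 N.+1; rewrite aS muln_gt0 => /andP[].
pose L : R := ln (d N)%:R; pose c : R := ln (a N)%:R - N.+1%:R * L.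
have lnaE n : (N <= n)%N -> ln (a n)%:R = c + n.+1%:R * L.
  move=> /subnK <-; elim: (n - N)%N => [|k IH].
    by rewrite add0n subrK.
  rewrite addSn aS dN ?leq_addl// natrM lnM ?posrE ?ltr0n// IH.
  by rewrite [in RHS]mulrSr mulrDl mul1r addrC addrA.
exists L; apply: cvg_trans.
  apply: (@near_eq_cvg _ _ _ _ (fun n => c * harmonic n + L)).
  near=> n; rewrite lnaE; last by near: n; exists N.
  by rewrite mulrDr mulrC mulKf ?pnatr_eq0.
suff : c * harmonic n + L @[n --> \oo] --> c * 0 + L by rewrite mulr0 add0r.
by apply: cvgD; [apply: cvgMl_tmp; exact: cvg_harmonic | exact: cvg_cst].
Unshelve. all: by end_near. Qed.

Section IndexGrowth.
Context {G : topologicalZmodType} (phi : {additive G -> G}) (U : set G).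
Hypotheses (phi_cont : continuous phi) (Uco : compact_open_subgroups U).
Local Notation T n := (trajectory phi n U).

Let Usub : zmod_closed [in U]. Proof. by case: Uco. Qed.
Let Tsub n : zmod_closed [in T n]. Proof. exact: trajectory_subgroup. Qed.

(** The steps start at [T_1 = U], since [T_1 / T_0] is [U] itself and may be infinite. Compactness
    of [phi U] makes the first step finite, and [phi] carries representatives from each step to the
    next. *)
Lemma finite_trajectory_step n : finite_set (quotient_set (T n.+2) (T n.+1)).
Proof.
elim: n => [|n IH].
  have [_ cU oU] := Uco.
  have cphiU : compact (phi @` U).
    exact: continuous_compact (continuous_subspaceT phi_cont) cU.
  have [I [e cov]] := compact_coset_cover Usub cphiU oU.
  apply: (@finite_quotient_cover _ I _ _ e) => //.
  move=> x /trajectory_recl-/(_ Usub)[u [y [Uu]]].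
  rewrite trajectory1// => Uy ->.
  have [i Ui] := cov (phi y) (imageP _ Uy); exists i.
  by rewrite -addrA; exact: subgroupD.
have [I [e [_ _ cov]]] := transversal_exists (Tsub n.+1) IH.
by apply: finite_quotient_cover => //; exact: coset_cover_trajectory cov.
Qed.

Lemma index_trajectory_step_le n :
  (subgroup_index (T n.+3) (T n.+2) <= subgroup_index (T n.+2) (T n.+1))%N.
Proof.
have [I [e tr]] := transversal_exists (Tsub n.+1) (finite_trajectory_step n).
rewrite (index_transversal (Tsub _) tr); have [_ _ cov] := tr.
by apply: index_cover => //; exact: coset_cover_trajectory cov.
Qed.

Lemma finite_trajectory_quotient n : finite_set (quotient_set (T n.+1) U).
Proof.
elim: n => [|n IH].
  apply: (@finite_quotient_cover _ unit _ _ (fun=> 0)) => //.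
  by move=> x; rewrite trajectory1// => Ux; exists tt; rewrite subr0.
by have [] := index_mul (Tsub n.+2) (Tsub n.+1) Usub
  (@trajectory_subS _ phi _ Usub n.+1) (@sub_trajectory _ phi _ Usub n)
  (finite_trajectory_step n) IH.
Qed.

Lemma index_trajectoryS n :
  subgroup_index (T n.+2) U =
    (subgroup_index (T n.+2) (T n.+1) * subgroup_index (T n.+1) U)%N.
Proof.
by have [] := index_mul (Tsub n.+2) (Tsub n.+1) Usub
  (@trajectory_subS _ phi _ Usub n.+1) (@sub_trajectory _ phi _ Usub n)
  (finite_trajectory_step n) (finite_trajectory_quotient n).
Qed.

Lemma index_trajectory_gt0 n : (0 < subgroup_index (T n.+1) U)%N.
Proof.
apply: index_gt0 => //; first exact: finite_trajectory_quotient.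
by exists 0; exact: subgroup0.
Qed.

Lemma cvg_ln_index_trajectory (R : realType) :
  exists l : R,
    (n.+1%:R^-1 * ln (subgroup_index (T n.+1) U)%:R : R) @[n --> \oo] --> l.
Proof.
apply: cvg_ln_growth (fun n => subgroup_index (T n.+2) (T n.+1)) _ _ _.
- exact: index_trajectory_gt0.
- exact: index_trajectoryS.
- exact: index_trajectory_step_le.
Qed.

End IndexGrowth.

(** The term of index 0 is set aside: in the entropies it has the factor [0^-1], and [T_0 = 0] need
    not contain [U]. *)
Lemma limn_EFinS (R : realType) (u : nat -> \bar R) (v : nat -> R) (l : R) :
  (forall n, u n.+1 = (v n)%:E) -> v n @[n --> \oo] --> l -> limn u = l%:E.
Proof.
move=> uv vl; apply: cvg_lim => //; rewrite -cvg_shiftS /=.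
under eq_fun do rewrite uv.
by apply: cvg_comp vl _; exact: cvg_id.
Qed.

Lemma lne_counting (R : realType) (T : choiceType) (X : set T) :
  finite_set X -> X !=set0 -> lne (counting X : \bar R) = (ln #|` fset_set X|%:R)%:E.
Proof.
move=> fX [x Xx]; rewrite /counting asboolT// lne_EFin// ltr0n cardfs_gt0.
by apply/fset0Pn; exists x; rewrite in_fset_set// inE.
Qed.

(** * Algebraic entropy as a real limit, and its monotonicity *)

Section GroupEntropy.
Context (R : realType) {G : topologicalZmodType} (phi : {additive G -> G}).
Hypothesis phi_cont : continuous phi.

Lemma halg_atE (U : set G) (l : R) : compact_open_subgroups U ->
  (n.+1%:R^-1 * ln (subgroup_index (trajectory phi n.+1 U) U)%:R : R)
    @[n --> \oo] --> l ->
  halg_at R phi U = l%:E.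
Proof.
move=> Uco; apply: limn_EFinS => n.
rewrite lne_counting//; first exact: finite_trajectory_quotient.
have [Usub _ _] := Uco; exists (coset_set 0 U), 0 => //.
exact: subgroup0 (trajectory_subgroup phi Usub _).
Qed.

Lemma halg_at_le (U U' : set G) :
  compact_open_subgroups U -> compact_open_subgroups U' -> U `<=` U' ->
  (halg_at R phi U <= halg_at R phi U')%E.
Proof.
move=> Uco U'co UU'.
have [Usub _ oU] := Uco; have [U'sub cU' _] := U'co.
have [l /[dup] ul /(halg_atE Uco) ->] := cvg_ln_index_trajectory phi_cont Uco R.
have [l' /[dup] ul' /(halg_atE U'co) ->] := cvg_ln_index_trajectory phi_cont U'co R.
rewrite lee_fin.
have fU'U := compact_open_finite_quotient Usub cU' oU.
have iU'U : (0 < subgroup_index U' U)%N.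
  by apply: index_gt0 => //; exists 0; exact: subgroup0.
(* The second term, [ln |U'/U|] divided by [n.+1], is the cost of replacing the quotient by [U] with
   the quotient by [U']; it tends to 0. *)
suff : (n.+1%:R^-1 * ln (subgroup_index (trajectory phi n.+1 U') U')%:R +
    ln (subgroup_index U' U)%:R * harmonic n) @[n --> \oo] -->
    l' + ln (subgroup_index U' U)%:R * 0.
  rewrite mulr0 addr0 => u'l'; apply: ler_cvg_to ul u'l' _.
  near=> n; rewrite [ln _ * _]mulrC /= -mulrDr ler_wpM2l ?invr_ge0//.
  have [fin indE] := index_mul (trajectory_subgroup phi U'sub n.+1) U'sub Usub
    (@sub_trajectory _ phi _ U'sub n) UU'
    (finite_trajectory_quotient phi_cont U'co n) fU'U.
  rewrite -lnM ?posrE ?ltr0n ?index_trajectory_gt0// -natrM -indE.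
  rewrite ler_ln ?posrE ?ltr0n ?index_trajectory_gt0//; last first.
    by rewrite indE muln_gt0 index_trajectory_gt0.
  by rewrite ler_nat; apply: index_le => //; exact: trajectory_subset.
by apply: cvgD => //; apply: cvgMl_tmp; exact: cvg_harmonic.
Unshelve. all: by end_near. Qed.

End GroupEntropy.

(** * Bases of quotient spaces over an arbitrary field *)

Section QuotientBasis.
Context {K : fieldType} {V : lmodType K}.
Implicit Types U W : set V.

Lemma subspaceZ W (Wsub : submod_closed [in W]) a x : W x -> W (a *: x).
Proof.
case: Wsub => W0 /(_ a x 0); rewrite addr0 !inE => WZ Wx.
by apply: WZ => //; exact/set_mem.
Qed.

Lemma subspace_intro W : W 0 -> (forall a x y, W x -> W y -> W (a *: x + y)) ->
  submod_closed [in W].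
Proof. by move=> W0 WD; split=> [|a x y]; rewrite !inE //; exact: WD. Qed.

(** Indexing by [nat] lets one notion serve for finite lists, read through [nth 0], and for all
    initial segments of an infinite sequence. *)
Definition free_mod U (n : nat) (e : nat -> V) :=
  forall c : nat -> K, U (\sum_(i < n) c i *: e i) -> forall i, (i < n)%N -> c i = 0.

(** In a relation modulo [U], a nonzero coefficient at [v] could be inverted, making [v] a
    combination of [s] modulo [U]. *)
Lemma free_mod_rcons U (s : seq V) (v : V) : submod_closed [in U] ->
  free_mod U (size s) (nth 0 s) ->
  ~ (exists c : nat -> K, U (v - \sum_(i < size s) c i *: s`_i)) ->
  free_mod U (size (rcons s v)) (nth 0 (rcons s v)).
Proof.
move=> Usub sfree vNs c; rewrite size_rcons big_ord_recr /=.
rewrite nth_rcons ltnn eqxx.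
under eq_bigr => i _ do rewrite nth_rcons ltn_ord.
move=> Ucs; have c0 : c (size s) = 0.
  apply/eqP/negP => /negP cN0; apply: vNs.
  exists (fun i => - ((c (size s))^-1 * c i)).
  rewrite -sumrN; under eq_bigr => i _ do rewrite scaleNr opprK -scalerA.
  rewrite -scaler_sumr -[X in X + _]scale1r -(mulVf cN0) -scalerA -scalerDr addrC.
  exact: subspaceZ.
move: Ucs; rewrite c0 scale0r addr0 => Ucs i.
by rewrite ltnS leq_eqVlt => /predU1P[->//|]; exact: sfree.
Qed.

(** Greedy construction: without a finite basis, every finite list of vectors of [W] free modulo [U]
    can be extended by one more vector of [W]. *)
Lemma quotient_basis_or_free_sequence W U : submod_closed [in U] ->
  (exists n (e : 'I_n -> V), quotient_basis W U e) \/
  (exists e : nat -> V, (forall i, W (e i)) /\ forall n, free_mod U n e).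
Proof.
move=> Usub.
have [?|nobasis] := pselect (exists n (e : 'I_n -> V), quotient_basis W U e).
  by left.
right; pose P (s : seq V) :=
  (forall i, (i < size s)%N -> W s`_i) /\ free_mod U (size s) (nth 0 s).
(* The choice is made for all lists, with the invariant [P] as a premise, so that [pick] is total
   and can be iterated. *)
have /choice[pick pickP] : forall s, exists v, P s -> P (rcons s v).
  move=> s; have [[Ws sfree]|NPs] := pselect (P s); last by exists 0.
  suff [v [Wv vNs]] : exists v, W v /\
      ~ (exists c : nat -> K, U (v - \sum_(i < size s) c i *: s`_i)).
    exists v => _; split=> [i|]; last exact: free_mod_rcons.
    by rewrite size_rcons ltnS nth_rcons leq_eqVlt => /predU1P[->|/[dup] /Ws ? ->//];
      rewrite ltnn eqxx.
  (* If no vector of [W] extends [s], then [s] itself is a finite basis. *)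
  apply: contra_notP nobasis => /forallNP noV.
  exists (size s), (fun i => s`_i); split=> [i|c Uc i|w Ww]; first exact: Ws.
  - pose c' j := oapp c 0 (insub j).
    have c'E (j : 'I_(size s)) : c' j = c j by rewrite /c' valK.
    rewrite -c'E; apply: sfree => //.
    by under eq_bigr do rewrite c'E.
  - have /not_andP[//|/contrapT[c Uc]] := noV w.
    by exists (fun i => c i).
(* [e n] is the vector added after [n] rounds, when the list consists of the first [n] values of
   [e]. *)
pose e n := pick (iter n (fun s => rcons s (pick s)) [::]).
have eE n : iter n (fun s => rcons s (pick s)) [::] = mkseq e n.
  by elim: n => //= n IH; rewrite -/(e n) {1}IH mkseqS.
have Pe n : P (mkseq e n).
  elim: n => [|n IH]; first by split=> // c _ i.
  by rewrite mkseqS /e eE; exact: pickP.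
exists e; split=> [i|n].
  by have [/(_ i)+ _] := Pe i.+1; rewrite size_mkseq nth_mkseq//; exact.
have [_] := Pe n; rewrite size_mkseq => efree c Uc; apply: efree.
by under eq_bigr => i _ do rewrite nth_mkseq//.
Qed.

Lemma free_mod_subr U (e : nat -> V) : (forall n, free_mod U n e) ->
  forall i j, U (e i - e j) -> i = j.
Proof.
move=> efree i j Uij; apply/eqP; apply/negP => /negP iNj.
pose n := (maxn i j).+1; have [i_n j_n] : (i < n /\ j < n)%N.
  by rewrite !ltnS leq_maxl leq_maxr.
have sumE k : (k < n)%N -> \sum_(l < n) (l == k :> nat)%:R *: e l = e k.
  move=> kn; rewrite (bigD1 (Ordinal kn))//= eqxx scale1r big1 ?addr0// => l.
  by rewrite -val_eqE /= => /negbTE ->; rewrite scale0r.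
(* If [i] and [j] differ, the relation given by [e i - e j] has coefficient 1 at [i], against
   freeness. *)
have := efree n (fun l => (l == i)%:R - (l == j)%:R) _ i i_n.
rewrite eqxx (negbTE iNj) subr0 => /(_ _)/eqP.
rewrite oner_eq0 => /(_ _)/negP; apply=> //.
under eq_bigr => l _ do rewrite scalerBl.
by rewrite sumrB !sumE.
Qed.

End QuotientBasis.

(** * Dimension and index over a finite field *)

Section FiniteField.
Context {F : finFieldType} {V : discreteTvsType F}.
Implicit Types U W : set V.

Lemma quotient_basis_transversal W U n (e : 'I_n -> V) :
  is_subspace W -> is_subspace U -> quotient_basis W U e ->
  coset_transversal W U (fun c : {ffun 'I_n -> F} => \sum_(i < n) c i *: e i).
Proof.
move=> Wsub Usub [We efree egen]; split=> [c|c c'|w /egen[c Uc]].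
- by apply: (subgroup_sum (GRing.submod_closedB Wsub)) => i _; exact: subspaceZ.
- rewrite -sumrB; under eq_bigr do rewrite -scalerBl.
  by move=> /efree cc'; apply/ffunP => i; apply/subr0_eq; exact: cc'.
- by exists [ffun i => c i]; under eq_bigr do rewrite ffunE.
Qed.

Lemma index_quotient_basis W U n (e : 'I_n -> V) :
  is_subspace W -> is_subspace U -> quotient_basis W U e ->
  subgroup_index W U = (#|F| ^ n)%N.
Proof.
move=> Wsub Usub /(quotient_basis_transversal Wsub Usub) tr.
by rewrite (index_transversal (GRing.submod_closedB Usub) tr) card_ffun card_ord.
Qed.

(** An infinite sequence free modulo [U] would have pairwise distinct classes in the finite
    quotient. *)
Lemma finite_quotient_basis W U : is_subspace U -> finite_set (quotient_set W U) ->
  exists n (e : 'I_n -> V), quotient_basis W U e.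
Proof.
move=> Usub fin; have [//|[e [We efree]]] := quotient_basis_or_free_sequence W Usub.
case: infinite_nat.
have <- : finite_set (range (fun i => coset_set (e i) U)) = finite_set [set: nat].
  apply/eq_finite_set/inj_card_eq => i j _ _ /coset_set_eq.
  by move=> /(_ (GRing.submod_closedB Usub))/(free_mod_subr efree).
by apply: sub_finite_set fin => _ [i _ <-]; exists (e i).
Qed.

Lemma quotient_dim_index (R : realType) W U :
  is_subspace W -> is_subspace U -> finite_set (quotient_set W U) ->
  quotient_dim R W U = (ln (subgroup_index W U)%:R / ln #|F|%:R)%:E.
Proof.
move=> Wsub Usub /(finite_quotient_basis Usub)[n [e eb]].
have F_gt1 : (1 < #|F|)%N := card_finNzRing_gt1 _.
(* A basis of size [m] makes the index [|F|^m], so all bases have the same size and the infimum is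
   over a singleton. *)
have -> : quotient_dim R W U = n%:R%:E.
  rewrite -[RHS]ereal_inf1; congr ereal_inf; apply/seteqP;
    split=> [_ [m [f fb] <-]|_ ->].
    have /eqP := index_quotient_basis Wsub Usub fb.
    by rewrite (index_quotient_basis Wsub Usub eb) eqn_exp2l// => /eqP ->.
  by exists n => //; exists e.
rewrite (index_quotient_basis Wsub Usub eb) natrX lnXn ?ltr0n 1?ltnW//.
by rewrite -[ln _ *+ n]mulr_natl mulfK// gt_eqF// ln_gt0// ltr1n.
Qed.

Lemma trajectory_subspace (phi : {linear V -> V}) U n :
  is_subspace U -> is_subspace (trajectory phi n U).
Proof.
move=> Usub; have Ugrp := GRing.submod_closedB Usub.
have Tsub := trajectory_subgroup phi Ugrp n.
apply: subspace_intro => [|a x y Tx Ty]; first exact: subgroup0 Tsub.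
apply: (subgroupD Tsub) => //; move: Tx => /trajectoryP[] // u Uu ->.
apply/trajectoryP => //; exists (fun i => a *: u i) => [i|]; first exact: subspaceZ.
rewrite scaler_sumr; apply: eq_bigr => -[i _] _ /=.
by elim: i (u i) => //= i IH v; rewrite -IH linearZ.
Qed.

(** From index 1 on, the two sequences are real and differ by the factor [ln |F|]; the limit is
    finite, so the division takes place in the reals. *)
Lemma halg_at_subspace (R : realType) (phi : {linear V -> V}) U :
  continuous phi -> is_subspace U -> compact U -> open U ->
  halg_at R phi U = (ent_at R phi U * (ln #|F|%:R)%:E)%E.
Proof.
move=> phi_cont Usub cU oU.
have Uco : compact_open_subgroups U by split=> //; exact: GRing.submod_closedB.
have [l /[dup] ul /(halg_atE phi_cont Uco) ->] := cvg_ln_index_trajectory phi_cont Uco R.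
have lnF_neq0 : ln #|F|%:R != 0 :> R.
  by rewrite gt_eqF// ln_gt0// ltr1n card_finNzRing_gt1.
suff -> : ent_at R phi U = (l / ln #|F|%:R)%:E by rewrite -EFinM divfK.
apply: limn_EFinS (cvgMr_tmp (b := (ln #|F|%:R)^-1) ul) => n.
rewrite quotient_dim_index//; first by rewrite -EFinM mulrA.
  exact: trajectory_subspace.
exact: finite_trajectory_quotient.
Qed.

End FiniteField.

(** * Linear compactness over an arbitrary field *)

Section LinearCompactness.
Context {K : fieldType} {V : discreteTvsType K}.
Implicit Types U W : set V.

Section FreeSequence.
Context (W : set V) (e : nat -> V).
Hypotheses (Wsub : is_subspace W) (efree : forall n, free_mod W n e).

Let Wgrp : zmod_closed [in W] := GRing.submod_closedB Wsub.
Local Notation S n := (\sum_(i < n) e i).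

(* The subspace W + <e i : n <= i>. *)
Definition tail_span (n : nat) : set V := [set x | exists c : nat -> K,
  (forall i, (i < n)%N -> c i = 0) /\
  \forall N \near \oo, W (x - \sum_(i < N) c i *: e i) /\ c N = 0].

Lemma sub_tail_span n : W `<=` tail_span n.
Proof.
move=> x Wx; exists (fun=> 0); split=> //; near=> N; split=> //.
by rewrite big1 ?subr0// => i _; rewrite scale0r.
Unshelve. all: by end_near. Qed.

Lemma tail_span_subspace n : is_subspace (tail_span n).
Proof.
apply: subspace_intro => [|a x y [c [c0 cx]] [d [d0 dy]]].
  by apply: sub_tail_span; exact: subgroup0.
exists (fun i => a * c i + d i); split=> [i i_n|].
  by rewrite c0// d0// mulr0 addr0.
apply: filterS2 cx dy => N [Wx cN] [Wy dN]; split; last by rewrite cN dN mulr0 addr0.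
under eq_bigr => i _ do rewrite scalerDl -scalerA.
rewrite big_split /= -scaler_sumr opprD addrACA -scalerBr.
by apply: (subgroupD Wgrp) => //; exact: subspaceZ.
Qed.

Lemma sum_indicator m N : (m <= N)%N -> \sum_(i < N) (i < m)%:R *: e i = S m.
Proof.
move=> mN; rewrite (big_ord_widen N e mN) [RHS]big_mkcond; apply: eq_bigr => i _.
by case: ifP => _; rewrite ?scale1r ?scale0r.
Qed.

(** Hence each [S n + tail_span n] contains all later partial sums, which will give the finite
    intersection property. *)
Lemma tail_span_sum n m : (n <= m)%N -> tail_span n (S m - S n).
Proof.
move=> nm; exists (fun i => (i < m)%:R - (i < n)%:R); split=> [i i_n|].
  by rewrite i_n (leq_trans i_n nm) subrr.
exists m => // N /= mN; split; last first.
  by rewrite !ltnNge mN (leq_trans nm mN) subrr.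
under [X in W (_ - X)]eq_bigr => i _ do rewrite scalerBl.
by rewrite sumrB !sum_indicator ?(leq_trans nm mN)// subrr; exact: subgroup0.
Qed.

(* The varieties S n + tail_span n decrease, but a common point would be congruent
   modulo W to the infinite sum of the e i. *)
Lemma tail_span_bigcap x : ~ (forall n, tail_span n (x - S n)).
Proof.
(* Modulo [W], [x] is the combination with coefficients [c], and [c] vanishes at [N0]. *)
move=> xS; have [c [_ [N0 _ cN0]]] := xS 0.
have [_ cN0_0] := cN0 N0 (leqnn N0).
(* The coefficients [d] of [x - S N0.+1] vanish up to [N0] included. *)
have [d [d0 [M0 _ dM0]]] := xS N0.+1.
pose M := maxn N0.+1 (maxn N0 M0).
have N0M : (N0.+1 <= M)%N by exact: leq_maxl.
have [Wc _] : W (x - S 0 - \sum_(i < M) c i *: e i) /\ c M = 0.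
  by apply: cN0; rewrite /= ltnW.
have [Wd _] : W (x - S N0.+1 - \sum_(i < M) d i *: e i) /\ d M = 0.
  by apply: dM0; rewrite /= /M !leq_max leqnn !orbT.
(* Comparing the two expansions of [x] gives the relation [b] modulo [W], whose coefficient at [N0]
   is [1 + 0 - 0 = 1]. *)
pose b i : K := (i < N0.+1)%:R + d i - c i.
have Wb : W (\sum_(i < M) b i *: e i).
  under eq_bigr => i _ do rewrite scalerBl scalerDl.
  rewrite sumrB big_split /= sum_indicator//.
  have := subgroupB Wgrp Wc Wd; rewrite big_ord0 subr0.
  by rewrite -[x - S _ - _]addrA -opprD opprB [x - _ + _]addrC addrA subrK.
have /eqP := efree Wb N0M; rewrite /b ltnSn d0// cN0_0 subr0 addr0.
by rewrite oner_eq0.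
Qed.

End FreeSequence.

(** An infinite sequence of [U] free modulo [W] would produce closed varieties of [U] with the
    finite intersection property and no common point. *)
Lemma linearly_compact_quotient_basis U W : is_subspace U -> is_subspace W ->
  W `<=` U -> open W -> linearly_compact U ->
  exists n (e : 'I_n -> V), quotient_basis U W e.
Proof.
move=> Usub Wsub WU oW lcU.
have [//|[e [Ue efree]]] := quotient_basis_or_free_sequence U Wsub.
have Ugrp := GRing.submod_closedB Usub; have Wgrp := GRing.submod_closedB Wsub.
pose X := tail_span W e; pose s n := \sum_(i < n) e i.
have Us (c : nat -> K) n : U (\sum_(i < n) c i *: e i).
  by apply: (subgroup_sum Ugrp) => i _; exact: subspaceZ.
have Xgrp n : zmod_closed [in X n] by exact/GRing.submod_closedB/tail_span_subspace.
pose C := [set coset_set (s n) (X n) | n in setT].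
have Ccl : C `<=` closed_linear_variety_in U.
  move=> _ [n _ <-]; exists (s n), (X n); split=> //.
  - by have := Us (fun=> 1) n; under eq_bigr do rewrite scale1r.
  - exact: tail_span_subspace.
  - move=> x [c [_ [N _ /(_ N (leqnn N))[/WU Ux _]]]].
    by rewrite -(subrK (\sum_(i < N) c i *: e i) x); exact: subgroupD.
  (* [X n] contains the open subspace [W], so it is open, hence closed. *)
  - suff Xcl : closed (X n) by exact: closed_subspaceW Xcl.
    apply: (open_subgroup_closed (Xgrp n)); apply: nbhs_subgroup_open => //.
    apply: filterS (@sub_tail_span W e n) _.
    by apply: open_nbhs_nbhs; split=> //; exact: subgroup0.
have Cfin : finI C id.
  (* Each member of [C] contains [s m] for all large [m], so it belongs to the filter [s @ \oo]. *)
  apply: (@filter_finI _ (s @ \oo)) => _ [n _ <-].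
  by exists n => // m /= nm; rewrite coset_setE; exact: tail_span_sum.
have [x xC] := lcU C Ccl Cfin.
exfalso; apply: (@tail_span_bigcap W e Wsub efree x) => n.
by have := xC (coset_set (s n) (X n)); rewrite coset_setE; apply; exists n.
Qed.

(** An open subgroup [U] is closed, so varieties closed in [U] are closed in [V], and compactness of
    [U] applies to them. *)
Lemma compact_linearly_compact U :
  is_subspace U -> open U -> compact U -> linearly_compact U.
Proof.
move=> Usub oU cU C Csub Cfin.
pose V' : ptopologicalType := HB.pack (Topological.sort V) (isPointed.Build V 0).
have : @compact V' U by []; rewrite compact_In0; apply=> //.
exists id => [A /Csub[v [W [Uv _ WU cW ->]]]|A /Csub[v [W [Uv _ WU cW ->]]]] /=.
  have -> : coset_set v W = (fun y => y - v) @^-1` W.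
    by apply/seteqP; split=> y /=; rewrite coset_setE.
  apply: closed_comp => [y _|]; first exact: continuous_subr.
  have cU' : closed U by apply: open_subgroup_closed => //; exact: GRing.submod_closedB.
  by have := closed_setIS W cU'; rewrite (setIidl WU) => ->.
rewrite setIidr// => y; rewrite coset_setE => /WU Uyv.
by rewrite -(subrK v y); apply: subgroupD => //; exact: GRing.submod_closedB.
Qed.

End LinearCompactness.

(** * Compact and linearly compact subspaces over a finite field *)

Section CompactSubspaces.
Context {F : finFieldType} {V : discreteTvsType F}.
Implicit Types U W : set V.

(* For every open subspace W of U, finiteness of U/W puts one coset of W in a given
   ultrafilter on U; a common point of these cosets is a limit of the ultrafilter. *)
Lemma linearly_compact_compact U : linearly_topologized V ->
  is_subspace U -> open U -> linearly_compact U -> compact U.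
Proof.
move=> [_ linV] Usub oU lcU; rewrite compact_ultra => FF FFultra FU.
have Ugrp := GRing.submod_closedB Usub.
have coset_in W : is_subspace W -> W `<=` U -> open W ->
    exists2 v, U v & FF (coset_set v W).
  move=> Wsub WU oW.
  have [n [e /(quotient_basis_transversal Usub Wsub)[Ue _ cov]]] :=
    linearly_compact_quotient_basis Usub Wsub WU oW lcU.
  apply: contrapT => nocoset.
  (* Otherwise the ultrafilter contains the complements of the finitely many cosets of [W] that
     cover [U], and these have no common point in [U]. *)
  have : FF (U `&` [set x | forall c : {ffun 'I_n -> F},
      (~` coset_set (\sum_(i < n) c i *: e i) W) x]).
    apply: filterI => //; apply: filter_forall => c.
    have [FFc|//] :=
      in_ultra_setVsetC (coset_set (\sum_(i < n) c i *: e i) W) FFultra.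
    by exfalso; apply: nocoset; exists (\sum_(i < n) c i *: e i).
  move=> /filter_ex[x [/cov[c Wxc] /(_ c)]]; apply.
  by rewrite coset_setE.
pose C : set (set V) := [set A | exists v W,
  [/\ U v, is_subspace W, W `<=` U, open W & A = coset_set v W] /\ FF A].
have Ccl : C `<=` closed_linear_variety_in U.
  move=> A [v [W [[Uv Wsub WU oW ->] _]]]; exists v, W; split=> //.
  suff Wcl : closed W by exact: closed_subspaceW Wcl.
  exact: open_subgroup_closed (GRing.submod_closedB Wsub) oW.
have Cfin : finI C id by apply: (@filter_finI _ FF) => A [v [W []]].
have [x xC] := lcU C Ccl Cfin.
exists x; split.
  have [v Uv FFv] := coset_in U Usub (@subset_refl _ U) oU.
  have : coset_set v U x by apply: xC; exists v, U; split=> //; split.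
  rewrite coset_setE => Uxv; rewrite -(subrK v x); exact: subgroupD.
move=> N xN.
(* The neighborhood [N] of [x] is translated to 0, where the linear topology supplies a subspace
   inside it. *)
have : nbhs 0 ((fun y => y - (- x)) @^-1` N).
  by apply: continuous_subr; rewrite sub0r opprK.
move=> /linV[W0 [W0sub W00 W0N]].
have W0grp := GRing.submod_closedB W0sub.
pose W := W0 `&` U.
have Wsub : is_subspace W.
  apply: subspace_intro => [|a y z [Wy Uy] [Wz Uz]].
    by split; exact: subgroup0.
  by split; apply: subgroupD => //; exact: subspaceZ.
have Wgrp := GRing.submod_closedB Wsub.
have oW : open W by apply: openI => //; exact: nbhs_subgroup_open.
have [v Uv FFv] := coset_in W Wsub (@subIsetr _ _ _) oW.
have : coset_set v W x.
  by apply: xC; exists v, W; split=> //; split=> //; exact: subIsetr.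
(* The coset [v + W] contains [x], so it equals [x + W] and lies in [N]. *)
rewrite coset_setE => Wxv; apply: filterS FFv => y; rewrite coset_setE => Wyv.
have [/W0N /=] : W (y - x).
  by have := subgroupB Wgrp Wyv Wxv; rewrite opprB addrA subrK.
by rewrite opprK subrK.
Qed.

Lemma lc_open_subspacesE : linearly_topologized V ->
  lc_open_subspaces V = [set U | [/\ is_subspace U, compact U & open U]].
Proof.
move=> linV; apply/seteqP; split=> U [Usub].
  by move=> oU lcU; split=> //; exact: linearly_compact_compact.
by move=> cU oU; split=> //; exact: compact_linearly_compact.
Qed.

Lemma compact_add_set (G : topologicalZmodType) (A B : set G) :
  compact A -> compact B -> compact (add_set A B).
Proof.
move=> cA cB; have -> : add_set A B = (fun p => p.1 + p.2) @` (A `*` B).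
  apply/seteqP; split=> [_ [a Aa [b Bb <-]]|_ [[a b] [/= Aa Bb] <-]].
    by exists (a, b).
  by exists a => //; exists b.
exact: continuous_compact (continuous_subspaceT add_continuous) (compact_setX cA cB).
Qed.

Lemma continuous_scale (a : F) : continuous ( *:%R a : V -> V).
Proof.
move=> y; apply: (@continuous_comp _ _ _ (fun y => (a : discrete_topology F, y))
  (fun z : discrete_topology F * V => (z.1 : F) *: z.2)).
  exact: cvg_pair (cvg_cst (a : discrete_topology F)) cvg_id.
exact: scale_discrete_continuous.
Qed.

(** The sum of the sets [a U] is compact because the scalars are finitely many, and open because the
    scalar 1 puts [U] inside it. *)
Lemma compact_open_subspace_hull U : compact_open_subgroups U ->
  exists U' : set V, [/\ is_subspace U', compact U', open U' & U `<=` U'].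
Proof.
move=> [Usub cU oU].
pose U' : set V := \big[@add_set V/[set 0]]_(a : F) ( *:%R a @` U).
have U'P x : U' x <-> exists2 u : F -> V, forall a, U (u a) & x = \sum_a a *: u a.
  rewrite /U' big_add_setP ?index_enum_uniq//;
    split=> [[v vU ->]|[u Uu ->]]; last first.
    by exists (fun a => a *: u a) => // a _; exists (u a).
  have /choice[u uP] a : exists u, U u /\ a *: u = v a.
    by have [u Uu <-] := vU a (mem_index_enum a); exists u.
  by exists u => [a|]; [exact: (uP a).1 | apply: eq_bigr => a _; rewrite (uP a).2].
have U'sub : is_subspace U'.
  apply: subspace_intro => [|b _ _ /U'P[u Uu ->] /U'P[v Uv ->]]; apply/U'P.
    exists (fun=> 0) => [a|]; first exact: subgroup0.
    by rewrite big1// => a; rewrite scaler0.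
  have [->|b0] := eqVneq b 0.
    by exists v => //; rewrite scale0r add0r.
  (* Multiplication by a nonzero [b] permutes the scalars, so the term of index [a] in the new sum
     comes from index [b^-1 * a]. *)
  exists (fun a => u (b^-1 * a) + v a) => [a|]; first exact: subgroupD.
  under [RHS]eq_bigr do rewrite scalerDr.
  rewrite big_split /= scaler_sumr; congr (_ + _).
  rewrite [RHS](reindex_inj (mulfI b0)); apply: eq_bigr => a _.
  by rewrite mulKf// scalerA.
have UU' : U `<=` U'.
  move=> x Ux; apply/U'P; exists (fun a => if a == 1 then x else 0) => [a|].
    by case: ifP => // _; exact: subgroup0.
  rewrite (bigD1 1)//= eqxx scale1r big1 ?addr0// => a /negbTE ->.
  by rewrite scaler0.
exists U'; split=> //.
  rewrite /U'; elim/big_ind: _ => [|A B|a _].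
  - exact: compact_set1.
  - exact: compact_add_set.
  - exact: continuous_compact (continuous_subspaceT (@continuous_scale a)) cU.
apply: nbhs_subgroup_open; first exact: GRing.submod_closedB.
by apply: filterS UU' _; apply: open_nbhs_nbhs; split=> //; exact: subgroup0.
Qed.

End CompactSubspaces.

(** * Comparison of the two suprema *)

Local Open Scope ereal_scope.

Theorem lemma3p10 (R : realType) (F : finFieldType) (V : discreteTvsType F)
    (phi : {linear V -> V}) (Vllc : locally_linearly_compact V)
    (phi_cont : continuous phi) :
  halg R phi = ent R phi * (ln (#|F|%:R : R))%:E.
Proof.
have [linV _] := Vllc.
have lnF_gt0 : (0 < ln (#|F|%:R : R))%R by rewrite ln_gt0// ltr1n card_finNzRing_gt1.
rewrite muleC /ent -ereal_sup_pZl// image_comp lc_open_subspacesE//.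
have halgE U : [/\ is_subspace U, compact U & open U] ->
    halg_at R phi U = (ln #|F|%:R)%:E * ent_at R phi U.
  by move=> [Usub cU oU]; rewrite halg_at_subspace// muleC.
(* For the upper bound, monotonicity replaces a compact open subgroup by its linear hull; for the
   lower bound, compact open subspaces are compact open subgroups. *)
apply/eqP; rewrite eq_le; apply/andP; split; apply: ub_ereal_sup => _ [U Uc <-].
  have [U' [U'sub cU' oU' UU']] := compact_open_subspace_hull Uc.
  apply: (@le_trans _ _ (halg_at R phi U')).
    apply: halg_at_le => //; split=> //; exact: GRing.submod_closedB.
  by apply: ereal_sup_ubound; exists U' => //=; rewrite halgE.
rewrite /= -halgE//; apply: ereal_sup_ubound; exists U => //.
by have [Usub cU oU] := Uc; split=> //; exact: GRing.submod_closedB.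
Qed.
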